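(* Let $n,q,t$ be positive integers with $t\ge 3$ and $n\ge 2$, and let $r\in\{0,1,\dots,t-2\}$ be the remainder of $n$ on division by $t-1$. If $M(\overline{t},n,q)>q$, then $$M(\overline{t},n,q)\le\max\{q^{\lceil n/(t-1)\rceil},\; r(q^{\lceil n/(t-1)\rceil}-1)+(t-1-r)(q^{\lfloor n/(t-1)\rfloor}-1)\}.$$
   Context: An $(n,M,q)$ code is a set $\mathcal{C}\subseteq Q^n$ of $M$ distinct codewords, $|Q|=q$. For $\mathcal{C}_0\subseteq\mathcal{C}$, let $\mathcal{C}_0(i)=\{\mathbf{c}(i):\mathbf{c}\in\mathcal{C}_0\}$ and $\mathsf{desc}(\mathcal{C}_0)=\mathcal{C}_0(1)\times\cdots\times\mathcal{C}_0(n)$. $\mathcal{C}$ is a strongly $\overline{t}$-separable code ($\overline{t}$-SSC$(n,M,q)$) if for every $\mathcal{C}_0\subseteq\mathcal{C}$ with $1\le|\mathcal{C}_0|\le t$, $\bigcap_{\mathcal{C}'\in S(\mathcal{C}_0)}\mathcal{C}'=\mathcal{C}_0$, where $S(\mathcal{C}_0)=\{\mathcal{C}'\subseteq\mathcal{C}:\mathsf{desc}(\mathcal{C}')=\mathsf{desc}(\mathcal{C}_0)\}$. $M(\overline{t},n,q)$ denotes the maximum $M$ such that a $\overline{t}$-SSC$(n,M,q)$ exists. *)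

(* Defs.v *)
From mathcomp Require Import all_boot.

Set Implicit Arguments.
Unset Strict Implicit.
Unset Printing Implicit Defensive.

Section Codes.

Variables (n : nat) (Q : finType).

Definition word := {ffun 'I_n -> Q}.

Implicit Types C : {set word}.

Definition coords C (i : 'I_n) : {set Q} := [set c i | c : word in C].

Definition desc C : {set word} := [set x : word | [forall i, x i \in coords C i]].

(* C is the ambient code and C0 the subcode. *)
Definition same_desc C C0 : {set {set word}} :=
  [set C' : {set word} | (C' \subset C) && (desc C' == desc C0)].

Definition strongly_separable (t : nat) C : bool :=
  [forall C0 : {set word}, (C0 \subset C) && (1 <= #|C0| <= t) ==>
     (\bigcap_(C' in same_desc C C0) C' == C0)].

End Codes.

(* The definition of a strongly separable code depends on the alphabet only
   up to bijection, so the maximum is taken over the alphabet 'I_q.  It ranges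
   over a finite nonempty family, since the empty code is admissible. *)
Definition maxSSC (t n q : nat) : nat :=
  \max_(C : {set word n 'I_q} | strongly_separable t C) #|C|.

(* Correct for 0 < d only. *)
Definition ceil_div (m d : nat) : nat := (m + (d - 1)) %/ d.

(* Main.v *)
(* Adjoining to a set of at most t - 1 codewords a codeword of its descendant
   set does not change that descendant set, so a strongly t-separable code is
   (t - 1)-frameproof.  Blackburn's argument for frameproof codes then applies:
   split the coordinates into t - 1 blocks as evenly as possible.  Each codeword
   is determined within the code by its restriction to some block, since otherwise
   it would be a descendant of at most t - 1 other codewords.  A block of size k
   determines at most q ^ k codewords, and if it determines exactly that many
   then it determines all of them. *)
Require Import Defs.
From mathcomp Require Import all_boot.
From mathcomp Require Import zify.

Set Implicit Arguments.
Unset Strict Implicit.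
Unset Printing Implicit Defensive.

Lemma card_ord_modn (n c j : nat) :
  j < c -> #|[set i : 'I_n | i %% c == j]| = n %/ c + (j < n %% c).
Proof.
move=> ltjc; have c_gt0 : 0 < c by apply: leq_ltn_trans ltjc.
rewrite -sum1dep_card big_mkcond /=.
elim: n => [|n IHn]; first by rewrite big_ord0 div0n mod0n.
rewrite big_ord_recr /= IHn divnS // modnS.
have lt_mod := ltn_pmod n c_gt0.
(* The new index [n] joins class [n %% c]; the quotient grows exactly when that is the last class,
   [c - 1]. *)
have -> : (c %| n.+1) = ((n %% c).+1 == c).
  rewrite {1}(divn_eq n c) -addnS dvdn_addr ?dvdn_mull //.
  by apply/idP/eqP => [/dvdn_leq | -> //]; lia.
by have [|] := eqVneq (n %% c).+1 c; have [|] := eqVneq (n %% c) j; lia.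
Qed.

Lemma ceil_divE (m d : nat) : 0 < d -> ceil_div m d = m %/ d + (0 < m %% d).
Proof.
move=> d_gt0; rewrite /ceil_div {1}(divn_eq m d) -addnA divnMDl //; congr addn.
have := ltn_pmod m d_gt0; case: (m %% d) => [|k] lt_k_d.
  by rewrite divn_small //; lia.
have -> : k.+1 + (d - 1) = 1 * d + k by lia.
by rewrite divnMDl // divn_small //; lia.
Qed.

Section Frameproof.

Variables (n : nat) (Q : finType).

Implicit Types (C : {set word n Q}) (S : {set 'I_n}).

Lemma strongly_separable_frameproof t C C0 x :
  strongly_separable t C -> C0 \subset C -> #|C0| < t ->
  x \in C -> x \in desc C0 -> x \in C0.
Proof.
move=> /forallP/(_ (x |: C0))/implyP sepC sC0C ltC0t Cx.
rewrite inE => /forallP descx.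
have sizeC0x : (x |: C0 \subset C) && (1 <= #|x |: C0| <= t).
  rewrite subUset sub1set Cx sC0C card_gt0 /=; apply/andP; split.
    by apply/set0Pn; exists x; rewrite setU11.
  by rewrite cardsU1; case: (x \notin C0) => //=; exact: ltnW.
have eq_coords i : coords C0 i = coords (x |: C0) i.
  by rewrite /coords imsetU1; apply/esym/setUidPr; rewrite sub1set descx.
have C0same : C0 \in same_desc C (x |: C0).
  rewrite inE sC0C; apply/eqP/setP => y; rewrite !inE.
  by apply: eq_forallb => i; rewrite eq_coords.
(* Separability makes [x |: C0] an intersection of a family that has [C0] as a member. *)
have := setU11 x C0; rewrite -{1}(eqP (sepC sizeC0x)).
by move/bigcapP; apply.
Qed.

Definition restr S (x : word n Q) : {ffun {i : 'I_n | i \in S} -> Q} :=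
  [ffun i => x (val i)].

Lemma restrP S (x y : word n Q) :
  reflect {in S, forall i, x i = y i} (restr S x == restr S y).
Proof.
apply: (iffP eqP) => [/ffunP eqxy i Si | eqxy].
  by have := eqxy (Sub i Si); rewrite !ffunE.
by apply/ffunP => -[i Si]; rewrite !ffunE /= eqxy.
Qed.

Definition own C S : {set word n Q} :=
  [set x in C | [forall y in C, (restr S x == restr S y) ==> (x == y)]].

Lemma ownP C S x y :
  x \in own C S -> y \in C -> restr S x = restr S y -> x = y.
Proof.
rewrite inE => /andP[_ /forall_inP ownx] /ownx/implyP eqxy /eqP.
by move/eqxy/eqP.
Qed.

Lemma card_restr_own C S : #|restr S @: own C S| = #|own C S|.
Proof.
apply: card_in_imset => x y ownx; rewrite inE => /andP[Cy _].
exact: ownP ownx Cy.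
Qed.

(** Under the hypothesis [restr S] maps [own C S] onto all words on [S], so every codeword shares
    its restriction with an owned one and hence equals it. *)
Lemma card_own_full C S :
  #|Q| ^ #|S| <= #|own C S| -> #|C| <= #|Q| ^ #|S|.
Proof.
have card_ran : #|{ffun {i : 'I_n | i \in S} -> Q}| = #|Q| ^ #|S|.
  by rewrite card_ffun card_sig.
rewrite -card_restr_own -card_ran -cardsT => full.
have /eqP restr_onto : restr S @: own C S == setT by rewrite eqEcard subsetT.
suffices sCown : C \subset own C S.
  by rewrite (leq_trans (subset_leq_card sCown)) // -card_restr_own restr_onto.
apply/subsetP => y Cy; have : restr S y \in [set: _] by rewrite inE.
rewrite -restr_onto => /imsetP[x ownx eqyx].
by rewrite -(ownP ownx Cy (esym eqyx)).
Qed.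

Lemma frameproof_own c C (S : 'I_c -> {set 'I_n}) :
  (forall C0 x, C0 \subset C -> #|C0| <= c ->
     x \in C -> x \in desc C0 -> x \in C0) ->
  (forall i, exists j, i \in S j) ->
  C \subset \bigcup_j own C (S j).
Proof.
move=> fpC coverS; apply/subsetP => x Cx; apply/negPn/negP => not_own.
(* For each block choose a codeword [f j] other than [x] that agrees with [x] there. As the blocks
   cover all coordinates, [x] descends from these at most [c] words. *)
have /fin_all_exists[f fP] j :
    exists y, [/\ y \in C, restr (S j) x == restr (S j) y & x != y].
  have: x \notin own C (S j).
    by apply: contra not_own => ownx; apply/bigcupP; exists j.
  rewrite inE Cx /= negb_forall_in => /exists_inP[y Cy].
  by rewrite negb_imply => /andP[]; exists y.
have: x \in f @: setT.
  apply: fpC => //.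
  - by apply/subsetP => _ /imsetP[j _ ->]; case: (fP j).
  - by rewrite (leq_trans (leq_imset_card _ _)) // cardsT card_ord.
  rewrite inE; apply/forallP => i; have [j Sji] := coverS i.
  have [_ /restrP eqxf _] := fP j.
  by rewrite eqxf //; apply/imset_f/imset_f; rewrite inE.
by case/imsetP => j _ eqxf; have [_ _] := fP j; rewrite {1}eqxf eqxx.
Qed.

Lemma card_frameproof_blocks c C (S : 'I_c -> {set 'I_n}) :
  C \subset \bigcup_j own C (S j) ->
  (exists j, #|C| <= #|Q| ^ #|S j|) \/
  #|C| <= \sum_(j < c) (#|Q| ^ #|S j| - 1).
Proof.
move=> sCown.
have [/existsP[j full] | /existsPn notfull] :=
  boolP [exists j, #|Q| ^ #|S j| <= #|own C (S j)|].
  by left; exists j; apply: card_own_full.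
right; apply: leq_trans (subset_leq_card sCown) _.
elim/big_rec2: _ => [|j m U _ leUm]; first by rewrite cards0.
(* Strictness in [notfull] makes the power positive, so the truncated subtraction of 1 is exact. *)
by have := notfull j; have [+ _] := leq_card_setU (own C (S j)) U; lia.
Qed.

End Frameproof.

Lemma sum_blocks (f : bool -> nat) (r c : nat) :
  r <= c -> \sum_(j < c) f (j < r) = r * f true + (c - r) * f false.
Proof.
move=> lerc; rewrite -(big_mkord xpredT (fun j => f (j < r))).
rewrite (big_cat_nat (n := r)) //=; congr (_ + _).
  rewrite (eq_big_nat _ _ (F2 := fun=> f true)) ?sum_nat_const_nat ?subn0 //.
  by move=> j /andP[_ ->].
rewrite (eq_big_nat _ _ (F2 := fun=> f false)) ?sum_nat_const_nat //.
by move=> j /andP[lerj _]; rewrite ltnNge lerj.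
Qed.

Theorem theorem4 (n q t : nat) (hn : 2 <= n) (hq : 1 <= q) (ht : 3 <= t) :
  let r := n %% (t - 1) in
  q < maxSSC t n q ->
  maxSSC t n q <=
    maxn (q ^ ceil_div n (t - 1))
         (r * (q ^ ceil_div n (t - 1) - 1)
          + (t - 1 - r) * (q ^ (n %/ (t - 1)) - 1)).
Proof.
move=> r _; apply/bigmax_leqP => C sepC.
have c_gt0 : 0 < t - 1 by lia.
have lt_r : r < t - 1 by rewrite ltn_pmod.
rewrite ceil_divE // -/r; set c := t - 1 in c_gt0 lt_r *.
(* Residue classes give [r] blocks of size [n %/ c + 1] and [c - r] of size [n %/ c]. *)
pose S (j : 'I_c) := [set i : 'I_n | i %% c == j].
have card_S j : #|S j| = n %/ c + (j < r) by rewrite card_ord_modn.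
have coverS i : exists j, i \in S j.
  by exists (Ordinal (ltn_pmod i c_gt0)); rewrite inE.
have fpC (C0 : {set word n 'I_q}) x : C0 \subset C -> #|C0| <= c ->
    x \in C -> x \in desc C0 -> x \in C0.
  by move=> sC0C leC0; apply: strongly_separable_frameproof sepC sC0C _; lia.
have [[j] | ] := card_frameproof_blocks (frameproof_own fpC coverS).
  rewrite card_S card_ord => leC; rewrite leq_max (leq_trans leC) //.
  (* A block with the extra coordinate has [j < r], which forces [0 < r]. *)
  by rewrite leq_pexp2l // leq_add2l; case: (j < r) (ltnP j r) => // -[]//; lia.
under eq_bigr do rewrite card_S card_ord.
rewrite (sum_blocks (fun b : bool => q ^ (n %/ c + b) - 1)) ?(ltnW lt_r) //= addn0.
rewrite leq_max => leC; apply/orP; right; apply: leq_trans leC _.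
(* The exponents [n %/ c + 1] and [n %/ c + (0 < r)] differ only for [r = 0], where the factor [r]
   kills the term. *)
by rewrite leq_add2r; case: (r).
Qed.
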